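(* For every finite sum $\mathbb A$ of expressions of the $\partial\lambda$-calculus with tests and every repetition-free list $\vec x$ of variables containing its free variables, $\llbracket\mathbb A\rrbracket_{\vec x}=\bigcup_{A\in\mathcal T(\mathbb A)}\llbracket A\rrbracket_{\vec x}$.
   Context: Syntax of the $\partial\lambda$-calculus with tests. Terms $M,N,L$, bags $P$, tests $V,W$: $M::=x\mid\lambda x.M\mid MP\mid\bar\tau(V)$, $P::=[L_1,\dots,L_k,\mathbb N^{!}]$, $V::=\tau[L_1,\dots,L_k]$ ($k\ge0$), where $\mathbb N$ is a finite sum (finite formal sum with idempotent addition, i.e. finite set) of terms; up to $\alpha$-equivalence. $[L_1,\dots,L_k]$ stands for $[L_1,\dots,L_k,0^!]$, $0$ being the empty sum. The expressions of the $\partial_0\lambda$-calculus with tests are those in which every bag has the form $[L_1,\dots,L_k]$. Taylor expansion. For a sum $\mathbb A$ of expressions of the $\partial\lambda$-calculus with tests, $\mathcal T(\mathbb A)$ is the set of $\partial_0\lambda$-expressions defined by: $\mathcal T(x)=\{x\}$; $\mathcal T(\lambda x.M)=\{\lambda x.M':M'\in\mathcal T(M)\}$; $\mathcal T(MP)=\{M'P':M'\in\mathcal T(M),P'\in\mathcal T(P)\}$; $\mathcal T(\bar\tau(V))=\{\bar\tau(V'):V'\in\mathcal T(V)\}$; $\mathcal T(\tau[M_1,\dots,M_k])=\{\tau[M'_1,\dots,M'_k]:M'_i\in\mathcal T(M_i)\}$; $\mathcal T([L_1,\dots,L_k,\mathbb N^!])=\{[L'_1,\dots,L'_k]\uplus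 P:L'_i\in\mathcal T(L_i),\ P\text{ a finite multiset of elements of }\mathcal T(\mathbb N)\}$; $\mathcal T(\sum_iA_i)=\bigcup_i\mathcal T(A_i)$. The model $\mathcal D$. $\mathcal M_f(S)$ = finite multisets over $S$; $D_0=\emptyset$, $D_{n+1}$ = $\mathbb N$-indexed sequences $(a_1,a_2,\dots)$ of elements of $\mathcal M_f(D_n)$ with all but finitely many empty; $\mathcal D=\bigcup_nD_n$; $a::(a_1,a_2,\dots):=(a,a_1,a_2,\dots)$; $*:=([\,],[\,],\dots)$; $\uplus$ on tuples componentwise. For a repetition-free list $\vec x=x_1,\dots,x_n$ containing the free variables: $\llbracket x_i\rrbracket_{\vec x}=\{(([\,],\dots,[\alpha],\dots,[\,]),\alpha):\alpha\in\mathcal D\}$ ($[\alpha]$ in position $i$); $\llbracket\lambda y.M\rrbracket_{\vec x}=\{(\vec a,b::\alpha):((\vec a,b),\alpha)\in\llbracket M\rrbracket_{\vec x,y}\}$; $\llbracket MP\rrbracket_{\vec x}=\{(\vec a_1\uplus\vec a_2,\alpha):\exists b\,(\vec a_1,b::\alpha)\in\llbracket M\rrbracket_{\vec x},(\vec a_2,b)\in\llbracket P\rrbracket_{\vec x}\}$; $\llbracket\bar\tau(V)\rrbracket_{\vec x}=\{(\vec a,* ):\vec a\in\llbracket V\rrbracket_{\vec x}\}$; $\llbracket[L_1,\dots,L_k,\mathbb N^!]\rrbracket_{\vec x}=\{(\biguplus_{r=1}^{k+m}\vec a_r,[\beta_1,\dots,\beta_{k+m}]):m\ge0,(\vec a_j,\beta_j)\in\llbracket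 L_j\rrbracket_{\vec x}\ (j\le k),(\vec a_i,\beta_i)\in\llbracket\mathbb N\rrbracket_{\vec x}\ (k<i\le k+m)\}$; $\llbracket\tau[L_1,\dots,L_k]\rrbracket_{\vec x}=\{\biguplus_i\vec a_i:(\vec a_i,* )\in\llbracket L_i\rrbracket_{\vec x}\}$; sums as unions. *)

(* Defs.v *)
From HB Require Import structures.
From mathcomp Require Import all_boot.
From mathcomp Require Import finmap multiset.
From mathcomp Require Import boolp classical_sets.
From Stdlib Require List.

Set Implicit Arguments.
Unset Strict Implicit.
Unset Printing Implicit Defensive.

Local Open Scope mset_scope.
Local Open Scope classical_set_scope.

(* The model D.  A point is a finitely supported sequence of finite multisets
   of points.  It is stored as a tree: [PStar] is the constantly empty sequence
   and [PCons s d] puts the multiset enumerated by [s] in front of [d]; [norm]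
   sorts the multisets and removes trailing empty ones, and [D] is the type of
   normal trees.  [nthD_inj], [nthD_surj] and [stageD_cover] say that [D] is
   the intended union of the stages D_n. *)

Inductive pretree := PStar | PCons of seq pretree & pretree.

Fixpoint pretree_enc (d : pretree) : GenTree.tree unit :=
  match d with
  | PStar => GenTree.Node 0 [::]
  | PCons s d' => GenTree.Node 0 (pretree_enc d' :: map pretree_enc s)
  end.

Fixpoint pretree_dec (t : GenTree.tree unit) : pretree :=
  match t with
  | GenTree.Node _ (t' :: s) => PCons (map pretree_dec s) (pretree_dec t')
  | _ => PStar
  end.

Fixpoint pretree_nested_ind (P : pretree -> Prop) (HS : P PStar)
    (HC : forall s d, List.Forall P s -> P d -> P (PCons s d)) (d : pretree) :
    P d :=
  match d with
  | PStar => HS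
  | PCons s d' =>
    HC s d'
      ((fix all_P s : List.Forall P s :=
          match s with
          | [::] => List.Forall_nil P
          | e :: s' =>
            List.Forall_cons e (pretree_nested_ind HS HC e) (all_P s')
          end) s)
      (pretree_nested_ind HS HC d')
  end.

Lemma pretree_encK : cancel pretree_enc pretree_dec.
Proof.
elim/pretree_nested_ind => //= s d Hs ->; congr PCons.
by elim: Hs => //= e s' -> _ ->.
Qed.

HB.instance Definition _ := Countable.copy pretree (can_type pretree_encK).

Definition pretree_le : rel pretree := relpre choice.pickle leq.

Lemma pretree_le_total : total pretree_le.
Proof. by move=> x y; apply: leq_total. Qed.

Lemma pretree_le_trans : transitive pretree_le.
Proof. by move=> y x z; apply: leq_trans. Qed.

Lemma pretree_le_anti : antisymmetric pretree_le.
Proof. by move=> x y /anti_leq /(pcan_inj choice.pickleK). Qed.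

Definition norm_cons (s : seq pretree) (d : pretree) : pretree :=
  match s, d with
  | [::], PStar => PStar
  | _, _ => PCons s d
  end.

Fixpoint norm (d : pretree) : pretree :=
  match d with
  | PStar => PStar
  | PCons s d' => norm_cons (sort pretree_le (map norm s)) (norm d')
  end.

Lemma sort_pretree_id s :
  sort pretree_le (sort pretree_le s) = sort pretree_le s.
Proof.
by apply: sorted_sort; [exact: pretree_le_trans
                       | exact: sort_sorted pretree_le_total _].
Qed.

Lemma norm_norm_cons s d :
  map norm s = s -> sort pretree_le s = s -> norm d = d ->
  norm (norm_cons s d) = norm_cons s d.
Proof.
move=> ns ss nd; case: s ns ss => [|e s] ns ss; case: d nd => [|s' d] nd //.
- by rewrite /norm_cons [norm (PCons _ _)]/= -/(norm (PCons s' d)) nd.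
- by rewrite /norm_cons [norm (PCons _ _)]/= -/(map norm (e :: s)) ns ss.
rewrite /norm_cons -[in RHS]ss -[in RHS]ns -[in RHS]nd.
by rewrite -[LHS]/(norm_cons (sort pretree_le (map norm (e :: s)))
                             (norm (PCons s' d))) nd ns ss.
Qed.

Lemma norm_idem d : norm (norm d) == norm d.
Proof.
apply/eqP; elim/pretree_nested_ind: d => // s d Hs nd.
apply: norm_norm_cons => //; last exact: sort_pretree_id.
have fixed : {in map norm s, norm =1 id}.
  elim: Hs => //= e s' ne _ IH x; rewrite inE => /orP[/eqP->//|]; exact: IH.
rewrite -[RHS]map_id; apply/eq_in_map => x; rewrite mem_sort; exact: fixed.
Qed.

Definition D : Type := {d : pretree | norm d == d}.

Definition toD (d : pretree) : D := exist _ (norm d) (norm_idem d).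

Definition starD : D := toD PStar.

Definition consD (a : {mset D}) (alpha : D) : D :=
  toD (PCons (map val (enum_mset a)) (val alpha)).

Notation "a ::: alpha" := (consD a alpha)
  (at level 60, right associativity, format "a  :::  alpha").

Fixpoint pretree_nth (d : pretree) (i : nat) : seq pretree :=
  match d, i with
  | PStar, _ => [::]
  | PCons s _, 0 => s
  | PCons _ d', i'.+1 => pretree_nth d' i'
  end.

Definition nthD (alpha : D) (i : nat) : {mset D} :=
  seq_mset (map toD (pretree_nth (val alpha) i)).

Fixpoint stageD (n : nat) : set D :=
  match n with
  | 0 => set0
  | n'.+1 => [set alpha | forall i beta, beta \in nthD alpha i ->
                                         stageD n' beta]
  end.

Lemma norm_val (alpha : D) : norm (val alpha) = val alpha.
Proof. exact: (eqP (valP alpha)). Qed.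

Lemma toD_val (alpha : D) : toD (val alpha) = alpha.
Proof. by apply: val_inj; apply: norm_val. Qed.

Lemma pretree_nth_cons0 s d : pretree_nth (norm_cons s d) 0 = s.
Proof. by case: s d => [|? ?] [|? ?]. Qed.

Lemma pretree_nth_consS s d i :
  pretree_nth (norm_cons s d) i.+1 = pretree_nth d i.
Proof. by case: s d => [|? ?] [|? ?]; case: i. Qed.

Lemma val_consD a alpha :
  val (a ::: alpha) =
  norm_cons (sort pretree_le (map val (enum_mset a))) (val alpha).
Proof.
rewrite -[LHS]/(norm_cons (sort _ (map norm (map val (enum_mset a))))
                          (norm (val alpha))).
by rewrite norm_val -map_comp (eq_map (f := norm \o val) norm_val).
Qed.

Lemma nthD_star i : nthD starD i = mset0.
Proof. by apply/msetP => x; rewrite mset0E mset_seqE. Qed.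

Lemma nthD_cons0 a alpha : nthD (a ::: alpha) 0 = a.
Proof.
rewrite /nthD val_consD pretree_nth_cons0 -[RHS]seq_mset_id.
apply/eq_seq_msetP.
rewrite (perm_trans (perm_map _ (permEl (perm_sort _ _)))) //.
by rewrite -map_comp (eq_map toD_val) map_id.
Qed.

Lemma nthD_consS a alpha i : nthD (a ::: alpha) i.+1 = nthD alpha i.
Proof. by rewrite /nthD val_consD pretree_nth_consS. Qed.

Fixpoint pretree_len (d : pretree) : nat :=
  if d is PCons _ d' then (pretree_len d').+1 else 0.

Lemma consD_surj (alpha : D) :
  exists2 beta : D, alpha = nthD alpha 0 ::: beta &
    pretree_len (val beta) = (pretree_len (val alpha)).-1.
Proof.
case: alpha => -[|s d] nd.
  have -> : exist _ PStar nd = starD by apply: val_inj.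
  exists starD => //; rewrite nthD_star; apply: val_inj.
  by rewrite val_consD enum_mset0.
have /eqP := nd; rewrite [norm _]/= => nE.
have [sE dE] : sort pretree_le (map norm s) = s /\ norm d = d.
  by move: nE; rewrite /norm_cons; case: (sort _ _) (norm d)
    => [|? ?] [|? ?] //= [].
exists (toD d); last by rewrite /= dE.
apply: val_inj; rewrite val_consD /= dE.
suff -> : sort pretree_le (map val (enum_mset (nthD (exist _ (PCons s d) nd) 0)))
          = s by rewrite -[LHS]nE sE dE.
rewrite -[RHS]sE; apply/perm_sortP;
  [exact: pretree_le_total | exact: pretree_le_trans | exact: pretree_le_anti |].
by rewrite (perm_trans (perm_map _ (perm_eq_seq_mset _))) //= -map_comp.
Qed.

Lemma nthD_inj (alpha beta : D) : nthD alpha =1 nthD beta -> alpha = beta.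
Proof.
have [n le_n] : exists n, pretree_len (val alpha) <= n /\
                          pretree_len (val beta) <= n.
  by exists (maxn (pretree_len (val alpha)) (pretree_len (val beta)));
    rewrite leq_maxl leq_maxr.
elim: n alpha beta le_n => [|n IH] alpha beta [la lb] E.
  suff st (g : D) : pretree_len (val g) <= 0 -> g = starD by rewrite (st _ la) (st _ lb).
  by case: g => -[|s d] nd //= _; apply: val_inj.
have [alpha' Ea la'] := consD_surj alpha.
have [beta' Eb lb'] := consD_surj beta.
rewrite Ea Eb E; congr consD; apply: IH => [|i].
  by rewrite la' lb' -!subn1 !leq_subLR !add1n.
by rewrite -(nthD_consS (nthD alpha 0)) -Ea E {1}Eb nthD_consS.
Qed.

Lemma nthD_surj (f : nat -> {mset D}) :
  (exists n, forall i, n <= i -> f i = mset0) ->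
  exists alpha, nthD alpha =1 f.
Proof.
case=> n; elim: n f => [|n IH] f f0.
  by exists starD => i; rewrite nthD_star f0.
have [i|alpha Ea] := IH (f \o succn); first exact: (f0 i.+1).
by exists (f 0 ::: alpha) => -[|i]; rewrite ?nthD_cons0 ?nthD_consS ?Ea.
Qed.

Fixpoint pretree_depth (d : pretree) : nat :=
  match d with
  | PStar => 1
  | PCons s d' =>
    maxn (foldr maxn 0 (map pretree_depth s)).+1 (pretree_depth d')
  end.

Lemma pretree_depth_nth d i e :
  e \in pretree_nth d i -> pretree_depth e < pretree_depth d.
Proof.
elim/pretree_nested_ind: d i => [|s d _ IH] [|i] //=; last first.
  by move/IH => lt_d; rewrite leq_max lt_d orbT.
move=> es; rewrite leq_max ltnS; apply/orP; left.
elim: s es => //= e' s IHs; rewrite inE leq_max.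
by case/orP => [/eqP->|/IHs ->]; rewrite ?leqnn ?orbT.
Qed.

Lemma pretree_nth_norm d i e :
  norm d = d -> e \in pretree_nth d i -> norm e = e.
Proof.
elim/pretree_nested_ind: d i => [|s d _ IH] [|i] //= nE.
  have <- : sort pretree_le (map norm s) = s.
    by move: nE; rewrite /norm_cons; case: (sort _ _) (norm d)
      => [|? ?] [|? ?] //= [].
  by rewrite mem_sort => /mapP[x _ ->]; apply/eqP/norm_idem.
apply: IH; move: nE; rewrite /norm_cons.
by case: (sort _ _) (norm d) => [|? ?] [|? ?] //= [].
Qed.

Lemma stageD_cover : \bigcup_n stageD n = setT.
Proof.
apply/seteqP; split=> // alpha _.
suff stage n : pretree_depth (val alpha) <= n -> stageD n alpha.
  by exists (pretree_depth (val alpha)) => //; apply: stage.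
elim: n alpha => [|n IH] alpha.
  by case: (val alpha) => //= s d; rewrite geq_max ltn0.
move=> le_n i beta; rewrite /nthD (perm_mem (perm_eq_seq_mset _)).
case/mapP => e e_i ->; apply: IH.
rewrite /= (pretree_nth_norm (norm_val alpha) e_i) -ltnS.
exact: leq_trans (pretree_depth_nth e_i) le_n.
Qed.

(* Syntax.  Variables are de Bruijn indices, so that alpha-equivalent terms are
   equal: an index [i + x] under [i] abstractions is the free variable [x].
   Lists stand for the multisets of bags and tests and for the finite sums:
   [Bag Ls Ns] is [L_1, ..., L_k, (N_1 + ... + N_l)^!].  The induced
   identification of expressions is [eqv_term], [eqv_bag], [eqv_test] below;
   the interpretation and the Taylor expansion respect it ([sem_eqv],
   [taylor_eqv]).  A bag [L_1, ..., L_k] without exponential part is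
   [Bag Ls [::]]. *)

Inductive term :=
  | Var of nat
  | Lam of term
  | App of term & bag
  | TauBar of test
with bag := Bag of seq term & seq term
with test := Tau of seq term.

HB.instance Definition _ := gen_eqMixin term.
HB.instance Definition _ := gen_choiceMixin term.

Fixpoint free_term (x : nat) (M : term) : bool :=
  match M with
  | Var y => x == y
  | Lam M' => free_term x.+1 M'
  | App M' P => free_term x M' || free_bag x P
  | TauBar V => free_test x V
  end
with free_bag (x : nat) (P : bag) : bool :=
  match P with
  | Bag Ls Ns => has (free_term x) Ls || has (free_term x) Ns
  end
with free_test (x : nat) (V : test) : bool :=
  match V with
  | Tau Ls => has (free_term x) Ls
  end.

Fixpoint resource_term (M : term) : bool :=
  match M with
  | Var _ => true
  | Lam M' => resource_term M'
  | App M' P => resource_term M' && resource_bag P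
  | TauBar V => resource_test V
  end
with resource_bag (P : bag) : bool :=
  match P with
  | Bag Ls Ns => all resource_term Ls && nilp Ns
  end
with resource_test (V : test) : bool :=
  match V with
  | Tau Ls => all resource_term Ls
  end.

Inductive eqv_term : term -> term -> Prop :=
  | EqvVar x : eqv_term (Var x) (Var x)
  | EqvLam M M' : eqv_term M M' -> eqv_term (Lam M) (Lam M')
  | EqvApp M M' P P' :
      eqv_term M M' -> eqv_bag P P' -> eqv_term (App M P) (App M' P')
  | EqvTauBar V V' : eqv_test V V' -> eqv_term (TauBar V) (TauBar V')
with eqv_bag : bag -> bag -> Prop :=
  | EqvBag Ls Ls' Ls'' Ns Ns' :
      List.Forall2 eqv_term Ls Ls' -> perm_eq Ls' Ls'' ->
      (forall N, N \in Ns -> exists2 N', N' \in Ns' & eqv_term N N') ->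
      (forall N', N' \in Ns' -> exists2 N, N \in Ns & eqv_term N N') ->
      eqv_bag (Bag Ls Ns) (Bag Ls'' Ns')
with eqv_test : test -> test -> Prop :=
  | EqvTau Ls Ls' Ls'' :
      List.Forall2 eqv_term Ls Ls' -> perm_eq Ls' Ls'' ->
      eqv_test (Tau Ls) (Tau Ls'').

(* The lists obtained by choosing one element in each of the given sets. *)
Definition choices {T : Type} (Ss : seq (set T)) : set (seq T) :=
  [set s | List.Forall2 (fun (S : set T) x => S x) Ss s].

(* The lists Q range over all enumerations of the multisets, which makes the
   expansion closed under [eqv] ([taylor_closed]). *)
Fixpoint taylor_term (M : term) : set term :=
  match M with
  | Var x => [set Var x]
  | Lam M' => [set Lam M1 | M1 in taylor_term M']
  | App M' P => [set App M1 P1 | M1 in taylor_term M' & P1 in taylor_bag P]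
  | TauBar V => [set TauBar V1 | V1 in taylor_test V]
  end
with taylor_bag (P : bag) : set bag :=
  match P with
  | Bag Ls Ns =>
    [set P1 | exists Ls1 Ns1 Q,
       [/\ choices [seq taylor_term L | L <- Ls] Ls1,
           forall N1, N1 \in Ns1 ->
             (\big[setU/set0]_(S <- [seq taylor_term N | N <- Ns]) S) N1,
           perm_eq Q (Ls1 ++ Ns1) & P1 = Bag Q [::]]]
  end
with taylor_test (V : test) : set test :=
  match V with
  | Tau Ls =>
    [set V1 | exists Ls1 Q,
       [/\ choices [seq taylor_term L | L <- Ls] Ls1,
           perm_eq Q Ls1 & V1 = Tau Q]]
  end.

Definition ctx (n : nat) : Type := n.-tuple {mset D}.

Definition ctx0 {n} : ctx n := [tuple mset0 | i < n].

Definition ctx1 {n} (i : 'I_n) (alpha : D) : ctx n :=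
  [tuple if j == i then [mset alpha] else mset0 | j < n].

Definition ctxD {n} (a b : ctx n) : ctx n :=
  [tuple (tnth a i `+` tnth b i)%mset | i < n].

(* Under an abstraction the list xs becomes xs, y where y is the index 0 and
   the variables of xs are shifted. *)
Fixpoint sem_term (n : nat) (xs : n.-tuple nat) (M : term) {struct M} :
    set (ctx n * D) :=
  match M with
  | Var x =>
    [set p | exists i alpha, tnth xs i = x /\ p = (ctx1 i alpha, alpha)]
  | Lam M' =>
    [set p | exists (a : ctx n) b alpha,
       sem_term [tuple of rcons (map succn xs) 0] M' ([tuple of rcons a b], alpha)
       /\ p = (a, b ::: alpha)]
  | App M' P =>
    [set p | exists a1 a2 b alpha,
       [/\ sem_term xs M' (a1, b ::: alpha), sem_bag xs P (a2, b)
         & p = (ctxD a1 a2, alpha)]]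
  | TauBar V => [set p | exists2 a, sem_test xs V a & p = (a, starD)]
  end
with sem_bag (n : nat) (xs : n.-tuple nat) (P : bag) {struct P} :
    set (ctx n * {mset D}) :=
  match P with
  | Bag Ls Ns =>
    [set p | exists s t : seq (ctx n * D),
       [/\ choices [seq sem_term xs L | L <- Ls] s,
           forall q, q \in t ->
             (\big[setU/set0]_(S <- [seq sem_term xs N | N <- Ns]) S) q
         & p = (\big[ctxD/ctx0]_(q <- s ++ t) q.1,
                seq_mset [seq q.2 | q <- s ++ t])]]
  end
with sem_test (n : nat) (xs : n.-tuple nat) (V : test) {struct V} :
    set (ctx n) :=
  match V with
  | Tau Ls =>
    [set a | exists2 s : seq (ctx n * D),
       choices [seq sem_term xs L | L <- Ls] s /\
         (forall q, q \in s -> q.2 = starD)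
       & a = \big[ctxD/ctx0]_(q <- s) q.1]
  end.

(* Sums are only formed of expressions of the same sort. *)
Inductive esort := STerm | SBag | STest.

Definition expr (k : esort) : Type :=
  match k with STerm => term | SBag => bag | STest => test end.

Definition point (k : esort) (n : nat) : Type :=
  match k with
  | STerm => ctx n * D
  | SBag => ctx n * {mset D}
  | STest => ctx n
  end.

Definition free {k} : nat -> expr k -> bool :=
  match k with
  | STerm => free_term | SBag => free_bag | STest => free_test
  end.

Definition taylor {k} : expr k -> set (expr k) :=
  match k with
  | STerm => taylor_term | SBag => taylor_bag | STest => taylor_test
  end.

Definition sem {k} {n} (xs : n.-tuple nat) : expr k -> set (point k n) :=
  match k with
  | STerm => sem_term xs | SBag => sem_bag xs | STest => sem_test xs
  end.

Definition resource {k} : expr k -> bool :=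
  match k with
  | STerm => resource_term | SBag => resource_bag | STest => resource_test
  end.

Definition eqv {k} : expr k -> expr k -> Prop :=
  match k with
  | STerm => eqv_term | SBag => eqv_bag | STest => eqv_test
  end.

Definition free_sum {k} (x : nat) (A : seq (expr k)) : bool := has (free x) A.

Definition taylor_sum {k} (A : seq (expr k)) : set (expr k) :=
  \big[setU/set0]_(B <- A) taylor B.

Definition sem_sum {k} {n} (xs : n.-tuple nat) (A : seq (expr k)) :
    set (point k n) :=
  \big[setU/set0]_(B <- A) sem xs B.

Lemma ctxE n (a b : ctx n) : (forall i, tnth a i = tnth b i) -> a = b.
Proof. exact: eq_from_tnth. Qed.

Lemma ctxDA n : associative (@ctxD n).
Proof. by move=> a b c; apply: ctxE => i; rewrite !tnth_mktuple msetDA. Qed.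

Lemma ctxDC n : commutative (@ctxD n).
Proof. by move=> a b; apply: ctxE => i; rewrite !tnth_mktuple msetDC. Qed.

Lemma ctx0D n : left_id (@ctx0 n) ctxD.
Proof. by move=> a; apply: ctxE => i; rewrite !tnth_mktuple mset0D. Qed.

HB.instance Definition _ n :=
  Monoid.isComLaw.Build (ctx n) ctx0 ctxD (@ctxDA n) (@ctxDC n) (@ctx0D n).

Lemma Forall_in (T : eqType) (P : T -> Prop) (s : seq T) :
  List.Forall P s -> forall x, x \in s -> P x.
Proof.
by elim=> // x {}s Px _ IH y; rewrite inE => /orP[/eqP->|/IH].
Qed.

Section NestedInduction.
Variables (P : term -> Prop) (Q : bag -> Prop) (T : test -> Prop).
Hypothesis PVar : forall x, P (Var x).
Hypothesis PLam : forall M, P M -> P (Lam M).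
Hypothesis PApp : forall M B, P M -> Q B -> P (App M B).
Hypothesis PTauBar : forall V, T V -> P (TauBar V).
Hypothesis QBag : forall Ls Ns,
  (forall L, L \in Ls -> P L) -> (forall N, N \in Ns -> P N) -> Q (Bag Ls Ns).
Hypothesis TTau : forall Ls, (forall L, L \in Ls -> P L) -> T (Tau Ls).

Fixpoint term_nested_ind (M : term) : P M :=
  match M with
  | Var x => PVar x
  | Lam M' => PLam (term_nested_ind M')
  | App M' B => PApp (term_nested_ind M') (bag_nested_ind B)
  | TauBar V => PTauBar (test_nested_ind V)
  end
with bag_nested_ind (B : bag) : Q B :=
  match B with
  | Bag Ls Ns =>
    let fix all_P s : List.Forall P s :=
      match s with
      | [::] => List.Forall_nil P
      | M :: s' => List.Forall_cons M (term_nested_ind M) (all_P s')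
      end
    in QBag (Forall_in (all_P Ls)) (Forall_in (all_P Ns))
  end
with test_nested_ind (V : test) : T V :=
  match V with
  | Tau Ls =>
    let fix all_P s : List.Forall P s :=
      match s with
      | [::] => List.Forall_nil P
      | M :: s' => List.Forall_cons M (term_nested_ind M) (all_P s')
      end
    in TTau (Forall_in (all_P Ls))
  end.

Lemma expr_nested_ind :
  [/\ forall M, P M, forall B, Q B & forall V, T V].
Proof. by split; [exact: term_nested_ind | exact: bag_nested_ind
                 | exact: test_nested_ind]. Qed.
End NestedInduction.

Lemma bigU_mapP (I : eqType) T (f : I -> set T) (s : seq I) x :
  (\big[setU/set0]_(S <- map f s) S) x <-> exists2 i, i \in s & f i x.
Proof.
elim: s => [|i s IH]; first by rewrite big_nil; split=> // -[].
rewrite /= big_cons; split=> [[fx|/IH[j js fx]]|[j]].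
- by exists i; rewrite ?mem_head.
- by exists j; rewrite ?inE ?js ?orbT.
rewrite inE => /orP[/eqP-> fx|js fx]; first by left.
by right; apply/IH; exists j.
Qed.

Lemma choices_cons T (S : set T) Ss s :
  choices (S :: Ss) s <-> exists x s', [/\ s = x :: s', S x & choices Ss s'].
Proof.
split=> [H|[x [s' [-> Sx Ss']]]]; last by constructor.
by inversion H as [|? x ? s' Sx Hs']; exists x, s'.
Qed.

Lemma choices_perm (I T : eqType) (f : I -> set T) u v s :
  perm_eq u v -> choices (map f u) s ->
  exists2 s', choices (map f v) s' & perm_eq s s'.
Proof.
elim: v u s => [|i v IH] u s; first by move/perm_nilP=> -> H; exists s.
move=> uv; have iu : i \in u by rewrite (perm_mem uv) mem_head.
case/splitPr: iu uv => u1 u2 uv.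
have {uv}/IH {}IH : perm_eq (u1 ++ u2) v.
  by rewrite -(perm_cons i) -(permPr uv) -cat1s perm_catCA.
rewrite map_cat /= => /List.Forall2_app_inv_l[s1 [s2 [H1 [H2 ->]]]].
have [x [s3 [-> fx H3]]] := (choices_cons _ _ _).1 H2.
have [|s' Hs' ps'] := IH (s1 ++ s3).
  by rewrite map_cat; apply: List.Forall2_app.
exists (x :: s'); first by apply/choices_cons; exists x, s'.
by rewrite -cat1s perm_catCA /= perm_cons.
Qed.

Lemma bigU_map_eq (I : eqType) T (f : I -> set T) (s s' : seq I) :
  (forall i, i \in s -> exists2 j, j \in s' & f i = f j) ->
  (forall j, j \in s' -> exists2 i, i \in s & f i = f j) ->
  \big[setU/set0]_(S <- map f s) S = \big[setU/set0]_(S <- map f s') S.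
Proof.
move=> ss' s's; apply/seteqP; split=> x /bigU_mapP[i iIn fi]; apply/bigU_mapP.
  by have [j js' E] := ss' i iIn; exists j; rewrite // -E.
by have [j js E] := s's i iIn; exists j; rewrite // E.
Qed.

Lemma map_Forall2_eq (I : eqType) T (f : I -> T) (R : I -> I -> Prop) s s' :
  (forall i, i \in s -> forall j, R i j -> f i = f j) ->
  List.Forall2 R s s' -> map f s = map f s'.
Proof.
move=> fR H; elim: H fR => //= i j {}s {}s' Rij _ IH fR.
rewrite (fR i _ j) ?mem_head // IH // => i' i's; apply: fR.
by rewrite inE i's orbT.
Qed.

Lemma sem_eqv_all :
  [/\ forall M M', eqv_term M M' ->
       forall n (xs : n.-tuple nat), sem_term xs M = sem_term xs M',
      forall P P', eqv_bag P P' ->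
       forall n (xs : n.-tuple nat), sem_bag xs P = sem_bag xs P'
    & forall V V', eqv_test V V' ->
       forall n (xs : n.-tuple nat), sem_test xs V = sem_test xs V'].
Proof.
apply: expr_nested_ind.
- by move=> x M' H; inversion H.
- by move=> M IH M1 H; inversion H as [|? M' e| |] => n xs /=; rewrite (IH _ e).
- move=> M P IHM IHP M1 H; inversion H as [| |? M' ? P' eM eP|] => n xs /=.
  by rewrite (IHM _ eM) (IHP _ eP).
- by move=> V IH M1 H; inversion H as [| | |? V' e] => n xs /=; rewrite (IH _ e).
- move=> Ls Ns IHL IHN P' H n xs.
  inversion H as [? Ls' Ls'' ? Ns' eL pL eN eN']; subst => /=.
  rewrite (map_Forall2_eq (f := sem_term xs) _ eL); last first.
    by move=> L Lin L' /(IHL _ Lin).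
  rewrite (bigU_map_eq (f := sem_term xs) (s := Ns) (s' := Ns')); first last.
  + by move=> N' /eN'[N Nin e]; exists N => //; apply: IHN.
  + by move=> N Nin; have [N' N'in e] := eN N Nin; exists N' => //; apply: IHN.
  apply/seteqP; split=> p [s [t [Hs Ht ->]]].
    have [s' Hs' ps] := choices_perm pL Hs; exists s', t; split=> //.
    have pst : perm_eq (s ++ t) (s' ++ t) by rewrite perm_cat2r.
    by rewrite (perm_big _ pst); congr pair; apply/eq_seq_msetP/perm_map.
  have pL' : perm_eq Ls'' Ls' by rewrite perm_sym.
  have [s' Hs' ps] := choices_perm pL' Hs; exists s', t; split=> //.
  have pst : perm_eq (s ++ t) (s' ++ t) by rewrite perm_cat2r.
  by rewrite (perm_big _ pst); congr pair; apply/eq_seq_msetP/perm_map.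
- move=> Ls IHL V' H n xs; inversion H as [? Ls' Ls'' eL pL]; subst => /=.
  rewrite (map_Forall2_eq (f := sem_term xs) _ eL); last first.
    by move=> L Lin L' /(IHL _ Lin).
  apply/seteqP; split=> p [s [Hs Hst ->]].
    have [s' Hs' ps] := choices_perm pL Hs; exists s'; last exact: perm_big.
    by split=> // q; rewrite -(perm_mem ps); apply: Hst.
  have pL' : perm_eq Ls'' Ls' by rewrite perm_sym.
  have [s' Hs' ps] := choices_perm pL' Hs; exists s'; last exact: perm_big.
  by split=> // q; rewrite -(perm_mem ps); apply: Hst.
Qed.

Lemma taylor_eqv_all :
  [/\ forall M M', eqv_term M M' -> taylor_term M = taylor_term M',
      forall P P', eqv_bag P P' -> taylor_bag P = taylor_bag P'
    & forall V V', eqv_test V V' -> taylor_test V = taylor_test V'].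
Proof.
apply: expr_nested_ind.
- by move=> x M' H; inversion H.
- by move=> M IH M1 H; inversion H as [|? M' e| |] => /=; rewrite (IH _ e).
- move=> M P IHM IHP M1 H; inversion H as [| |? M' ? P' eM eP|] => /=.
  by rewrite (IHM _ eM) (IHP _ eP).
- by move=> V IH M1 H; inversion H as [| | |? V' e] => /=; rewrite (IH _ e).
- move=> Ls Ns IHL IHN P' H.
  inversion H as [? Ls' Ls'' ? Ns' eL pL eN eN']; subst => /=.
  rewrite (map_Forall2_eq (f := taylor_term) _ eL) //.
  rewrite (bigU_map_eq (f := taylor_term) (s := Ns) (s' := Ns')); first last.
  + by move=> N' /eN'[N Nin e]; exists N => //; apply: IHN.
  + by move=> N Nin; have [N' N'in e] := eN N Nin; exists N' => //; apply: IHN.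
  have pL' : perm_eq Ls'' Ls' by rewrite perm_sym.
  apply/seteqP; split=> p [s [t [Q [Hs Ht pQ ->]]]].
    have [s' Hs' ps] := choices_perm pL Hs; exists s', t, Q; split=> //.
    by rewrite (permPl pQ) perm_cat2r.
  have [s' Hs' ps] := choices_perm pL' Hs; exists s', t, Q; split=> //.
  by rewrite (permPl pQ) perm_cat2r.
- move=> Ls IHL V' H; inversion H as [? Ls' Ls'' eL pL]; subst => /=.
  rewrite (map_Forall2_eq (f := taylor_term) _ eL) //.
  have pL' : perm_eq Ls'' Ls' by rewrite perm_sym.
  apply/seteqP; split=> p [s [Q [Hs pQ ->]]].
    have [s' Hs' ps] := choices_perm pL Hs; exists s', Q; split=> //.
    by rewrite (permPl pQ).
  have [s' Hs' ps] := choices_perm pL' Hs; exists s', Q; split=> //.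
  by rewrite (permPl pQ).
Qed.

Lemma sem_eqv k (A B : expr k) n (xs : n.-tuple nat) :
  eqv A B -> sem xs A = sem xs B.
Proof.
have [HM HP HV] := sem_eqv_all; case: k A B => A B e.
- exact: HM e n xs.
- exact: HP e n xs.
- exact: HV e n xs.
Qed.

Lemma taylor_eqv k (A B : expr k) : eqv A B -> taylor A = taylor B.
Proof.
have [HM HP HV] := taylor_eqv_all.
by case: k A B => A B e; [apply: HM | apply: HP | apply: HV].
Qed.

Lemma choices_mem (I T : eqType) (f : I -> set T) u s x :
  choices (map f u) s -> x \in s -> exists2 i, i \in u & f i x.
Proof.
elim: u s => [|i u IH] s; first by move=> H; inversion H.
case/choices_cons => y [s' [-> fy Hs']]; rewrite inE => /orP[/eqP->|xs'].
  by exists i; rewrite ?mem_head.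
by have [j ju fx] := IH _ Hs' xs'; exists j; rewrite // inE ju orbT.
Qed.

Lemma taylor_resource k (A B : expr k) : taylor A B -> resource B.
Proof.
suff [HM HP HV] :
    [/\ forall M, forall M', taylor_term M M' -> resource_term M',
        forall P, forall P', taylor_bag P P' -> resource_bag P'
      & forall V, forall V', taylor_test V V' -> resource_test V'].
  by case: k A B => A B; [apply: HM | apply: HP | apply: HV].
apply: expr_nested_ind => /=.
- by move=> x _ ->.
- by move=> M IH _ [M' /IH ? <-].
- by move=> M P IHM IHP _ [M' /IHM rM [P' /IHP rP <-]] /=; rewrite rM.
- by move=> V IH _ [V' /IH ? <-].
- move=> Ls Ns IHL IHN _ [s [t [Q [Hs Ht pQ ->]]]] /=; rewrite andbT.
  apply/allP=> M; rewrite (perm_mem pQ) mem_cat => /orP[Ms|/Ht].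
    by have [L Lin HL] := choices_mem Hs Ms; apply: IHL HL.
  by case/bigU_mapP => N Nin HN; apply: IHN HN.
- move=> Ls IHL _ [s [Q [Hs pQ ->]]] /=.
  apply/allP=> M; rewrite (perm_mem pQ) => Ms.
  by have [L Lin HL] := choices_mem Hs Ms; apply: IHL HL.
Qed.

Lemma eqv_refl k (A : expr k) : eqv A A.
Proof.
suff [HM HP HV] :
    [/\ forall M, eqv_term M M, forall P, eqv_bag P P & forall V, eqv_test V V].
  by case: k A => A; [apply: HM | apply: HP | apply: HV].
have F2 Ls : (forall L, L \in Ls -> eqv_term L L) -> List.Forall2 eqv_term Ls Ls.
  elim: Ls => [|L Ls IH] H; constructor; first by apply: H; rewrite mem_head.
  by apply: IH => L' L'in; apply: H; rewrite inE L'in orbT.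
apply: expr_nested_ind; try by constructor.
- move=> Ls Ns IHL IHN; apply: EqvBag (F2 _ IHL) (perm_refl _) _ _.
    by move=> N Nin; exists N => //; apply: IHN.
  by move=> N Nin; exists N => //; apply: IHN.
- by move=> Ls IHL; apply: EqvTau (F2 _ IHL) (perm_refl _).
Qed.

Lemma choices_map_trans (I T : eqType) (f : I -> set T) (R : T -> T -> Prop) u s s' :
  (forall i x y, i \in u -> f i x -> R x y -> f i y) ->
  choices (map f u) s -> choices (map R s) s' -> choices (map f u) s'.
Proof.
elim: u s s' => [|i u IH] s s' fR Hs; first by inversion Hs; subst.
case/choices_cons: Hs => x [s1 [-> fx Hs1]].
move=> /choices_cons[y [s2 [-> xy Hs2]]]; apply/choices_cons; exists y, s2.
split=> //; first by apply: fR xy; rewrite ?mem_head.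
by apply: IH Hs1 Hs2 => j ? ? ju; apply: fR; rewrite inE ju orbT.
Qed.

Lemma choices_catl (I T : Type) (f : I -> set T) u v s :
  choices (map f (u ++ v)) s ->
  exists s1 s2, [/\ choices (map f u) s1, choices (map f v) s2 & s = s1 ++ s2].
Proof.
rewrite map_cat => /List.Forall2_app_inv_l[s1 [s2 [H1 [H2 ->]]]].
by exists s1, s2.
Qed.

Lemma choices_map_Forall2 (I T : Type) (f : I -> set T) u s :
  choices (map f u) s <-> List.Forall2 f u s.
Proof.
elim: u s => [|i u IH] s; first by split=> H; inversion H.
split=> [/choices_cons[x [s' [-> fx /IH]]]|H]; first by constructor.
inversion H as [|? x ? s' fx Hs']; apply/choices_cons; exists x, s'.
by split=> //; apply/IH.
Qed.

Lemma taylor_closed k (A B C : expr k) : eqv B C -> taylor A B -> taylor A C.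
Proof.
suff [HM HP HV] :
    [/\ forall M, forall B C, eqv_term B C -> taylor_term M B -> taylor_term M C,
        forall P, forall B C, eqv_bag B C -> taylor_bag P B -> taylor_bag P C
      & forall V, forall B C, eqv_test B C -> taylor_test V B -> taylor_test V C].
  by case: k A B C => A B C; [apply: HM | apply: HP | apply: HV].
apply: expr_nested_ind => {A B C} /=.
- by move=> x B C e E; rewrite /set1 /= in E; subst; inversion e.
- move=> M IH B C e [M1 H E]; subst; inversion e as [|? M' e'| |]; subst.
  by exists M' => //; apply: IH e' H.
- move=> M P IHM IHP B C e [M1 H1 [P1 H2 E]]; subst.
  inversion e as [| |? M' ? P' e1 e2|]; subst.
  by exists M'; [apply: IHM e1 H1 | exists P'; [apply: IHP e2 H2|]].
- move=> V IH B C e [V1 H E]; subst; inversion e as [| | |? V' e']; subst.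
  by exists V' => //; apply: IH e' H.
- move=> Ls Ns IHL IHN B C e [s [t [Q [Hs Ht pQ E]]]]; subst.
  inversion e as [? Q' Q'' ? Ns' eL pL eN eN']; subst.
  have -> : Ns' = [::].
    by case: Ns' eN' {eN e} => // N Ns' /(_ N (mem_head _ _))[].
  have [W HW pW] := choices_perm pQ ((choices_map_Forall2 eqv_term _ _).2 eL).
  have [s1 [t1 [Hs1 Ht1 W1]]] := choices_catl HW.
  exists s1, t1, Q''; split=> //.
  + by apply: choices_map_trans Hs Hs1 => L x y Lin Lx xy; apply: IHL xy Lx.
  + move=> N1 /(choices_mem Ht1)[x xt xN1]; apply/bigU_mapP.
    have /bigU_mapP[N Nin Nx] := Ht _ xt.
    by exists N => //; apply: IHN xN1 Nx.
  + by rewrite -W1 -(permPl pL).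
- move=> Ls IHL B C e [s [Q [Hs pQ E]]]; subst.
  inversion e as [? Q' Q'' eL pL]; subst.
  have [W HW pW] := choices_perm pQ ((choices_map_Forall2 eqv_term _ _).2 eL).
  exists W, Q''; split=> //; last by rewrite -(permPl pL).
  by apply: choices_map_trans Hs HW => L x y Lin Lx xy; apply: IHL xy Lx.
Qed.

(* Main.v *)
(** By induction on the expression: a point of [[L_1, ..., L_k, N^!]] uses each
    [L_j] once and finitely many points of the interpretation of [N]; choosing
    for each of these a Taylor approximant whose interpretation contains it
    gives exactly a linear bag of the expansion.  Different copies of [N] may
    thus be approximated differently. *)

Require Import Defs.
From mathcomp Require Import all_boot.
From mathcomp Require Import finmap multiset.
From mathcomp Require Import boolp classical_sets.

Local Open Scope mset_scope.
Local Open Scope classical_set_scope.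

(** A product of unions is the union of the products: the approximant in one position is chosen
    independently of the others. The equation is asked only on members of [u], which is what the
    nested induction supplies. *)
Lemma choices_bigcup {I : eqType} {T U : Type} {f : I -> set T}
    {g : T -> set U} {h : I -> set U} {u : seq I} (s : seq U) :
  (forall i, i \in u -> h i = \bigcup_(x in f i) g x) ->
  choices (map h u) s <->
  exists2 r, choices (map f u) r & choices (map g r) s.
Proof.
elim: u s => [|i u IH] s hE.
  split=> [H|[r H]]; first by exists [::] => //; constructor.
  by inversion H.
have {}IH s' := IH s' (fun j ju => hE j (@mem_behead _ (i :: u) j ju)).
split=> [/choices_cons[y [s' [-> + /IH[r fr gr]]]]|
         [r /choices_cons[x [r' [-> fx fr]]]]].
  rewrite hE ?mem_head // => -[x fx gx].
  by exists (x :: r); apply/choices_cons; [exists x, r | exists y, s'].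
move=> /choices_cons[y [s' [-> gy gs]]]; apply/choices_cons; exists y, s'.
by split=> //; [rewrite hE ?mem_head //; exists x | apply/IH; exists r'].
Qed.

(** For the exponential part: every entry of [t] gets its own witness in [S], so [r] is as long as
    [t] and may repeat elements. *)
Lemma choices_bigcup_seq {T U : eqType} {S : set T} {g : T -> set U}
    {t : seq U} :
  (forall q, q \in t -> (\bigcup_(x in S) g x) q) ->
  exists2 r, (forall x, x \in r -> S x) & choices (map g r) t.
Proof.
elim: t => [|q t IH] tS; first by exists [::] => //; constructor.
have [x Sx gx] := tS q (mem_head _ _).
have [|r Sr gr] := IH; first by move=> q' q't; apply: tS; rewrite inE q't orbT.
exists (x :: r); last by apply/choices_cons; exists q, t.
by move=> y; rewrite inE => /orP[/eqP->|/Sr].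
Qed.

Lemma bigU_map_bigcup {I : eqType} {T U : Type} {f : I -> set T}
    {g : T -> set U} {h : I -> set U} {u : seq I} :
  (forall i, i \in u -> h i = \bigcup_(x in f i) g x) ->
  \big[setU/set0]_(S <- map h u) S =
  \bigcup_(x in \big[setU/set0]_(S <- map f u) S) g x.
Proof.
move=> hE; apply/seteqP; split=> q.
  move/bigU_mapP=> [i iu]; rewrite hE // => -[x fx gx].
  by exists x => //; apply/bigU_mapP; exists i.
move=> [x /bigU_mapP[i iu fx] gx]; apply/bigU_mapP; exists i => //.
by rewrite hE //; exists x.
Qed.

Lemma sem_linear_bag n (xs : n.-tuple nat) (Ls : seq term)
    (p : ctx n * {mset D}) :
  sem_bag xs (Bag Ls [::]) p <->
  exists2 s, choices (map (sem_term xs) Ls) s &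
    p = (\big[ctxD/ctx0]_(q <- s) q.1, seq_mset (map snd s)).
Proof.
split=> [[s [[|q t] [Ls_s t0 ->]]]|[s Ls_s ->]].
- by exists s => //; rewrite cats0.
(* An entry of [t] would lie in the union over no terms, which is empty. *)
- by have := t0 q (mem_head _ _); rewrite /= big_nil.
by exists s, [::]; split=> //; rewrite cats0.
Qed.

(** [n] and [xs] are quantified after the expression because the abstraction case uses the induction
    hypothesis at the list extended by the bound variable. *)
Lemma sem_taylor_all :
  [/\ forall M n (xs : n.-tuple nat),
        sem_term xs M = \bigcup_(M1 in taylor_term M) sem_term xs M1,
      forall P n (xs : n.-tuple nat),
        sem_bag xs P = \bigcup_(P1 in taylor_bag P) sem_bag xs P1
    & forall V n (xs : n.-tuple nat),
        sem_test xs V = \bigcup_(V1 in taylor_test V) sem_test xs V1].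
Proof.
apply: expr_nested_ind.
- by move=> x n xs; rewrite /taylor_term bigcup_set1.
- move=> M IH n xs; apply/seteqP; split=> p /=.
    move=> [a [b [alpha [+ ->]]]]; rewrite IH => -[M1 tM1 sM1].
    by exists (Lam M1); [exists M1 | exists a, b, alpha].
  move=> [_ [M1 tM1 <-]] [a [b [alpha [sM1 ->]]]]; exists a, b, alpha.
  by split=> //; rewrite IH; exists M1.
- move=> M P IHM IHP n xs; apply/seteqP; split=> p /=.
    move=> [a1 [a2 [b [alpha [+ + ->]]]]]; rewrite IHM IHP.
    move=> [M1 tM1 sM1] [P1 tP1 sP1]; exists (App M1 P1).
      by exists M1 => //; exists P1.
    by exists a1, a2, b, alpha.
  move=> [_ [M1 tM1 [P1 tP1 <-]]] [a1 [a2 [b [alpha [sM1 sP1 ->]]]]].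
  exists a1, a2, b, alpha; split=> //; first by rewrite IHM; exists M1.
  by rewrite IHP; exists P1.
- move=> V IH n xs; apply/seteqP; split=> p /=.
    move=> [a + ->]; rewrite IH => -[V1 tV1 sV1].
    by exists (TauBar V1); [exists V1 | exists a].
  by move=> [_ [V1 tV1 <-]] [a sV1 ->]; exists a => //; rewrite IH; exists V1.
- move=> Ls Ns IHL IHN n xs.
  have chL s := choices_bigcup s (fun L Lin => IHL L Lin n xs).
  have UN := bigU_map_bigcup (fun N Nin => IHN N Nin n xs).
  apply/seteqP; split=> p.
    move=> [s [t [/chL[Ls1 tL sL] + ->]]].
    rewrite UN => /choices_bigcup_seq[Ns1 tN sN].
    (* Any enumeration of the multiset is allowed; this one matches the order of [s ++ t]. *)
    exists (Bag (Ls1 ++ Ns1) [::]); first by exists Ls1, Ns1, (Ls1 ++ Ns1).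
    apply/sem_linear_bag; exists (s ++ t) => //.
    by rewrite map_cat; apply: List.Forall2_app.
  move=> [_ [Ls1 [Ns1 [Q [tL tN pQ ->]]]] /sem_linear_bag[q sQ ->]].
  (* [Q] lists [Ls1 ++ Ns1] in arbitrary order. Permuting the points along with it lets them be cut
     into a linear part [s] and an exponential part [t]; context sums and multisets do not see the
     order. *)
  have [q' + pq] := choices_perm pQ sQ.
  move=> /choices_catl[s [t [sL sN q'E]]]; subst q'.
  exists s, t; split; first by apply/chL; exists Ls1.
    move=> r rt; rewrite UN.
    by have [N1 N1in sr] := choices_mem sN rt; exists N1 => //; apply: tN.
  by rewrite (perm_big _ pq); congr pair; apply/eq_seq_msetP/perm_map.
- move=> Ls IHL n xs.
  have chL s := choices_bigcup s (fun L Lin => IHL L Lin n xs).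
  apply/seteqP; split=> p.
    move=> [s [/chL[Ls1 tL sL] s_star] ->].
    (* The same points [s] serve the approximant, so the condition that they end in [starD] carries
       over. *)
    by exists (Tau Ls1); [exists Ls1, Ls1 | exists s].
  move=> [_ [Ls1 [Q [tL pQ ->]]] [q [sQ q_star] ->]].
  have [s sL pq] := choices_perm pQ sQ.
  exists s; last exact: perm_big.
  split; first by apply/chL; exists Ls1.
  by move=> r; rewrite -(perm_mem pq); apply: q_star.
Qed.

Lemma sem_taylor k (A : expr k) n (xs : n.-tuple nat) :
  sem xs A = \bigcup_(B in taylor A) sem xs B.
Proof.
have [HM HP HV] := sem_taylor_all.
by case: k A => A; [apply: HM | apply: HP | apply: HV].
Qed.

Theorem theorem8p4 (k : esort) (A : seq (expr k)) (n : nat) (xs : n.-tuple nat)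
    (uniq_xs : uniq xs) (free_xs : forall x : nat, free_sum x A -> x \in xs) :
  sem_sum xs A = \bigcup_(B in taylor_sum A) sem xs B.
Proof.
(* Both sides turn sums into unions, so the claim reduces to single expressions. *)
rewrite /sem_sum /taylor_sum; elim: A {free_xs} => [|B A IH].
  by rewrite !big_nil bigcup_set0.
by rewrite !big_cons bigcup_setU -IH -sem_taylor.
Qed.
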